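(* Let $n\ge 2$, let $H$ and $K$ be $n$-Hilbert spaces over the same field, let $a_2,\dots,a_n\in H$ be linearly independent and $b_2,\dots,b_n\in K$ be linearly independent. Let $\{p_i\}_{i=1}^\infty,\{e_i\}_{i=1}^\infty$ be a pair of dual frames associated to $(a_2,\dots,a_n)$ for $H$ and let $\{q_j\}_{j=1}^\infty,\{h_j\}_{j=1}^\infty$ be a pair of dual frames associated to $(b_2,\dots,b_n)$ for $K$. Suppose $U\in\mathcal B(H_F)$ and $V\in\mathcal B(K_G)$ are unitary operators. Then $\Lambda=\{(U\otimes V)(p_i\otimes q_j)\}_{i,j=1}^\infty$ and $\Gamma=\{(U\otimes V)(e_i\otimes h_j)\}_{i,j=1}^\infty$ also form a pair of dual frames associated to $(a_2\otimes b_2,\dots,a_n\otimes b_n)$ for $H\otimes K$.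
   Context: Let $\mathbb K$ be $\mathbb R$ or $\mathbb C$. An $n$-inner product on a $\mathbb K$-linear space $H$ with $\dim H\ge n$ is a map $\langle\cdot,\cdot\,|\,\cdot,\dots,\cdot\rangle:H^{n+1}\to\mathbb K$ such that for all $x,y,z,x_1,\dots,x_n\in H$ and $\alpha\in\mathbb K$: (i) $\langle x_1,x_1|x_2,\dots,x_n\rangle\ge 0$, with equality iff $x_1,\dots,x_n$ are linearly dependent; (ii) $\langle x,y|x_2,\dots,x_n\rangle=\langle x,y|x_{i_2},\dots,x_{i_n}\rangle$ for every permutation $(i_2,\dots,i_n)$ of $(2,\dots,n)$; (iii) $\langle x,y|x_2,\dots,x_n\rangle=\overline{\langle y,x|x_2,\dots,x_n\rangle}$; (iv) $\langle\alpha x,y|x_2,\dots,x_n\rangle=\alpha\langle x,y|x_2,\dots,x_n\rangle$; (v) $\langle x+y,z|x_2,\dots,x_n\rangle=\langle x,z|x_2,\dots,x_n\rangle+\langle y,z|x_2,\dots,x_n\rangle$. The induced $n$-norm is $\|x_1,\dots,x_n\|=\sqrt{\langle x_1,x_1|x_2,\dots,x_n\rangle}$. $H$ is an $n$-Hilbert space if every sequence $\{x_k\}$ with $\lim_{l,k\to\infty}\|x_l-x_k,e_2,\dots,e_n\|=0$ for all $e_2,\dots,e_n\in H$ has some $x\in H$ with $\lim_k\|x_k-x,e_2,\dots,e_n\|=0$ for all $e_2,\dots,e_n\in H$. Denote the $n$-inner products and $n$-norms of $H$, $K$ with subscripts $1$, $2$. A sequence $\{p_i\}$ in $H$ is a frame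 associated to $(a_2,\dots,a_n)$ for $H$ if there are constants $0<A\le B<\infty$ with $A\|p,a_2,\dots,a_n\|_1^2\le\sum_{i=1}^\infty|\langle p,p_i|a_2,\dots,a_n\rangle_1|^2\le B\|p,a_2,\dots,a_n\|_1^2$ for all $p\in H$; similarly for $K$. Let $L_F$ be the span of $F=\{a_2,\dots,a_n\}$ in $H$. The formula $\langle p+L_F,q+L_F\rangle_F=\langle p,q|a_2,\dots,a_n\rangle_1$ is an inner product on $H/L_F$, and $H_F$ is its Hilbert space completion; elements of $H$ are regarded in $H_F$ via their classes, and for $u,v\in H_F$ one writes $\langle u,v|a_2,\dots,a_n\rangle_1=\langle u,v\rangle_F$, $\|u,a_2,\dots,a_n\|_1=\|u\|_F$. $K_G$ is defined in the same way from $K$ and $G=\{b_2,\dots,b_n\}$. $\mathcal B(X)$ denotes the bounded linear operators on $X$. $H_F\otimes K_G$ is the Hilbert space tensor product, with $\langle p\otimes q,p'\otimes q'\rangle=\langle p,p'\rangle_F\langle q,q'\rangle_G$, and $U\otimes V$ is the bounded operator with $(U\otimes V)(f\otimes g)=Uf\otimes Vg$. A frame $\{e_i\}$ associated to $(a_2,\dots,a_n)$ is a dual frame of a frame $\{p_i\}$ associated to $(a_2,\dots,a_n)$ if $p=\sum_{i=1}^\infty\langle p,e_i|a_2,\dots,a_n\rangle_1\,p_i$ for all $p\in H$, where equality and convergence are in $H_F$; $\{p_i\},\{e_i\}$ are then called a pair of dual frames. Similarly for $K$ (equality in $K_G$). Write $\langle p\otimes q,p'\otimes q'|a_2\otimes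 b_2,\dots,a_n\otimes b_n\rangle=\langle p,p'|a_2,\dots,a_n\rangle_1\langle q,q'|b_2,\dots,b_n\rangle_2$ and $\|p\otimes q,a_2\otimes b_2,\dots,a_n\otimes b_n\|=\|p,a_2,\dots,a_n\|_1\|q,b_2,\dots,b_n\|_2$. A family $\{u_i\otimes v_j\}_{i,j}$ with $u_i\in H_F$, $v_j\in K_G$ is a frame associated to $(a_2\otimes b_2,\dots,a_n\otimes b_n)$ for $H\otimes K$ if there are $0<A\le B<\infty$ such that, for all $p\in H$, $q\in K$, $A\|p\otimes q,a_2\otimes b_2,\dots,a_n\otimes b_n\|^2\le\sum_{i,j=1}^\infty|\langle p\otimes q,u_i\otimes v_j|a_2\otimes b_2,\dots,a_n\otimes b_n\rangle|^2\le B\|p\otimes q,a_2\otimes b_2,\dots,a_n\otimes b_n\|^2$. Two such frames $\{u_i\otimes v_j\}$ and $\{u_i'\otimes v_j'\}$ form a pair of dual frames associated to $(a_2\otimes b_2,\dots,a_n\otimes b_n)$ for $H\otimes K$ if $p\otimes q=\sum_{i,j=1}^\infty\langle p\otimes q,u_i'\otimes v_j'|a_2\otimes b_2,\dots,a_n\otimes b_n\rangle\,(u_i\otimes v_j)$ for all $p\in H$, $q\in K$, with equality and convergence in $H_F\otimes K_G$. *)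

(* Defs.v *)
From HB Require Import structures.
From mathcomp Require Import all_boot all_order all_algebra.
From mathcomp Require Import perm sesquilinear.
From mathcomp Require Import complex.
From mathcomp Require Import all_classical all_reals all_analysis.
From mathcomp.analysis Require showcase.summability.

Set Implicit Arguments.
Unset Strict Implicit.
Unset Printing Implicit Defensive.

Import Order.TTheory GRing.Theory Num.Theory.
Import numFieldNormedType.Exports.

Local Open Scope classical_set_scope.
Local Open Scope ring_scope.

Inductive scalar_kind := RealScalars | ComplexScalars.

Definition scalar_field (R : realType) (k : scalar_kind) : numFieldType :=
  match k with
  | RealScalars => R
  | ComplexScalars => R[i]%C
  end.

Definition scalar_conj (R : realType) (k : scalar_kind) :
    scalar_field R k -> scalar_field R k :=
  match k return scalar_field R k -> scalar_field R k with
  | RealScalars => fun x => x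
  | ComplexScalars => fun z : R[i]%C => Num.conj z
  end.

Definition scalar_Re (R : realType) (k : scalar_kind) : scalar_field R k -> R :=
  match k return scalar_field R k -> R with
  | RealScalars => fun x => x
  | ComplexScalars => fun z => complex.Re z
  end.

(* MathComp's norm on a numFieldType is valued in the field itself; this is
   the same number, seen in R. *)
Definition modulus (R : realType) (k : scalar_kind) (z : scalar_field R k) : R :=
  scalar_Re `|z|.

Section NInnerProducts.
Variables (R : realType) (k : scalar_kind).
Local Notation K := (scalar_field R k).

Definition linearly_independent (H : lmodType K) m (v : m.-tuple H) : Prop :=
  forall c : 'I_m -> K,
    \sum_(i < m) c i *: tnth v i = 0 -> forall i, c i = 0.

Definition in_span (H : lmodType K) m (v : m.-tuple H) (x : H) : Prop :=
  exists c : 'I_m -> K, x = \sum_(i < m) c i *: tnth v i.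

(* [ip x y e] is <x, y | e_2, ..., e_n>; the n - 1 vectors after the bar form
   the tuple e. *)
Definition n_inner_product n (H : lmodType K)
    (ip : H -> H -> n.-1.-tuple H -> K) : Prop :=
  [/\ forall (x : H) (e : n.-1.-tuple H), 0 <= ip x x e /\
        (ip x x e = 0 <-> ~ linearly_independent [tuple of x :: e]),
      forall (x y : H) (e : n.-1.-tuple H) (s : 'S_n.-1),
        ip x y e = ip x y [tuple tnth e (s i) | i < n.-1],
      forall (x y : H) (e : n.-1.-tuple H),
        ip x y e = scalar_conj (ip y x e),
      forall (alpha : K) (x y : H) (e : n.-1.-tuple H),
        ip (alpha *: x) y e = alpha * ip x y e
    & forall (x y z : H) (e : n.-1.-tuple H),
        ip (x + y) z e = ip x z e + ip y z e].

Definition n_norm n (H : lmodType K) (ip : H -> H -> n.-1.-tuple H -> K)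
    (x : H) (e : n.-1.-tuple H) : R :=
  Num.sqrt (scalar_Re (ip x x e)).

Definition n_complete n (H : lmodType K)
    (ip : H -> H -> n.-1.-tuple H -> K) : Prop :=
  forall x_ : nat -> H,
    (forall e : n.-1.-tuple H,
      (fun lk : nat * nat => n_norm ip (x_ lk.1 - x_ lk.2) e) @ (\oo, \oo)
        --> (0 : R)) ->
    exists x : H, forall e : n.-1.-tuple H,
      (fun i => n_norm ip (x_ i - x) e) @ \oo --> (0 : R).

Definition n_hilbert_space n (H : lmodType K)
    (ip : H -> H -> n.-1.-tuple H -> K) : Prop :=
  [/\ exists v : n.-tuple H, linearly_independent v,
      n_inner_product ip
    & n_complete ip].

Record hilbertSpace := HilbertSpace {
  hilbert_sort :> completeNormedModType K;
  inner : {dot hilbert_sort for @scalar_conj R k};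
  norm_inner : forall x : hilbert_sort, `|x| ^+ 2 = inner x x
}.

(* A Hilbert space completion of H / L_F, where F = a and L_F is the span of
   F, presented by the composite H -> H / L_F -> H_F.  It is unique up to a
   unique unitary isomorphism compatible with [hclass]. *)
Record completion n (H : lmodType K) (ip : H -> H -> n.-1.-tuple H -> K)
    (a : n.-1.-tuple H) := Completion {
  completion_space :> hilbertSpace;
  hclass : {linear H -> completion_space};
  hclass_ker : forall p, hclass p = 0 <-> in_span a p;
  hclass_inner : forall p q, inner _ (hclass p) (hclass q) = ip p q a;
  hclass_dense : dense (range hclass)
}.

(* The Hilbert space tensor product of X and Y, likewise unique up to a unique
   unitary isomorphism compatible with [tens]. *)
Record hilbertTensor (X Y : hilbertSpace) := HilbertTensor {
  tensor_space :> hilbertSpace;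
  tens : {bilinear X -> Y -> tensor_space};
  tens_inner : forall x y x' y',
    inner _ (tens x y) (tens x' y') = inner _ x x' * inner _ y y';
  tens_dense : dense [set t : tensor_space |
    exists m (x : 'I_m -> X) (y : 'I_m -> Y), t = \sum_(i < m) tens (x i) (y i)]
}.

Definition bounded_operator (X Y : hilbertSpace) (U : {linear X -> Y}) : Prop :=
  exists M : K, forall x, `|U x| <= M * `|x|.

Definition adjoint (X : hilbertSpace) (U U' : {linear X -> X}) : Prop :=
  forall x y, inner _ (U x) y = inner _ x (U' y).

Definition unitary_operator (X : hilbertSpace) (U : {linear X -> X}) : Prop :=
  bounded_operator U /\
  exists U' : {linear X -> X},
    [/\ bounded_operator U', adjoint U U',
        forall x, U (U' x) = x & forall x, U' (U x) = x].

Definition tensor_operator (X Y : hilbertSpace) (T : hilbertTensor X Y)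
    (U : {linear X -> X}) (V : {linear Y -> Y}) (W : {linear T -> T}) : Prop :=
  bounded_operator W /\ forall f g, W (tens T f g) = tens T (U f) (V g).

Definition frame n (H : lmodType K) (ip : H -> H -> n.-1.-tuple H -> K)
    (a : n.-1.-tuple H) (p_ : nat -> H) : Prop :=
  exists A B : R, [/\ 0 < A, A <= B & forall p : H,
    ((A * n_norm ip p a ^+ 2)%:E <=
       \sum_(i <oo) (modulus (ip p (p_ i) a) ^+ 2)%:E <=
       (B * n_norm ip p a ^+ 2)%:E)%E].

Definition dual_frames n (H : lmodType K) (ip : H -> H -> n.-1.-tuple H -> K)
    (a : n.-1.-tuple H) (HF : completion ip a) (p_ e_ : nat -> H) : Prop :=
  [/\ frame ip a p_, frame ip a e_
    & forall p : H,
        series (fun i => ip p (e_ i) a *: hclass HF (p_ i)) @ \oo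
          --> hclass HF p].

Section TensorFrames.
Variables (n : nat) (H1 H2 : lmodType K).
Variables (ip1 : H1 -> H1 -> n.-1.-tuple H1 -> K)
          (ip2 : H2 -> H2 -> n.-1.-tuple H2 -> K).
Variables (a : n.-1.-tuple H1) (b : n.-1.-tuple H2).
Variables (HF : completion ip1 a) (KG : completion ip2 b).

(* <f (x) g, f' (x) g' | a_2 (x) b_2, ..., a_n (x) b_n> *)
Definition tensor_ip (f : HF) (g : KG) (f' : HF) (g' : KG) : K :=
  inner _ f f' * inner _ g g'.

Definition tensor_n_norm (p : H1) (q : H2) : R :=
  n_norm ip1 p a * n_norm ip2 q b.

Definition tensor_frame (u : nat -> HF) (v : nat -> KG) : Prop :=
  exists A B : R, [/\ 0 < A, A <= B & forall (p : H1) (q : H2),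
    ((A * tensor_n_norm p q ^+ 2)%:E <=
       \esum_(ij in [set: nat * nat])
         (modulus (tensor_ip (hclass HF p) (hclass KG q)
                             (u ij.1) (v ij.2)) ^+ 2)%:E <=
       (B * tensor_n_norm p q ^+ 2)%:E)%E].

(* The double series converges unconditionally: along the finite subsets of
   nat * nat directed by inclusion. *)
Definition dual_tensor_frames (T : hilbertTensor HF KG)
    (w w' : nat -> nat -> T) : Prop :=
  exists (u u' : nat -> HF) (v v' : nat -> KG),
    [/\ (forall i j, w i j = tens T (u i) (v j)) /\ tensor_frame u v,
        (forall i j, w' i j = tens T (u' i) (v' j)) /\ tensor_frame u' v'
      & forall (p : H1) (q : H2),
          summability.partial_sum (fun ij : nat * nat =>
            tensor_ip (hclass HF p) (hclass KG q) (u' ij.1) (v' ij.2)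
              *: tens T (u ij.1) (v ij.2)) @ summability.totally
          --> tens T (hclass HF p) (hclass KG q)].

End TensorFrames.

End NInnerProducts.

(* Main.v *)
Require Import Defs.
From HB Require Import structures.
From mathcomp Require Import all_boot all_order all_algebra.
From mathcomp Require Import sesquilinear.
From mathcomp Require Import all_classical all_reals all_analysis.
From mathcomp Require Import complex finmap ring lra.
From mathcomp.analysis Require showcase.summability.

(** A pair of dual frames is a pair of Bessel sequences with a reconstruction
    formula, and all of this passes from [H] to the completion [H_F]: a Bessel
    bound need only be tested on a dense subspace ([bessel_dense]), and the
    partial reconstruction operators are then uniformly bounded, so that their
    convergence to the identity also extends by density ([frame_sum_dense]).
    Having the reconstruction formula on all of [H_F], one may transport it by a
    unitary operator, [U x_i] and [U y_i] reconstructing [x = U (U' x)], where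
    [U'] is the adjoint of [U] ([dual_systems_unitary]). The extension is
    necessary here, since [U' x] need not come from [H] when [x] does. Conversely
    two Bessel systems with a reconstruction formula are frames: the lower bound
    of one follows from the Bessel bound of the other
    ([dual_systems_frame_left], [dual_systems_frame_right]).

    Since [W (p_i (x) q_j) = U p_i (x) V q_j], it remains to treat two pairs of
    dual systems, one in each factor. The frame inequalities of the tensor
    system are the products of those of the factors, because the double sum of
    squared coefficients of an elementary tensor factors
    ([esum_coef2_tens]). The reconstruction formula holds along the squares
    [i, j < N], where the partial sum is the tensor product of two partial
    reconstructions. To obtain unconditional convergence one needs a Bessel
    bound for the doubly indexed system in the tensor product
    ([bessel_tens_fset]): the norm of a finite sum of the tensors with
    coefficients [c_ij] is controlled by the l2 norm of [c]. It follows from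
    [bessel_tens], which bounds a finite sum of tensors [x_i (x) z_i] by the
    Bessel bound of the [x_i] and the norms of arbitrary vectors [z_i], and is
    proved by orthogonalising the [z_i]. Applied to the coefficients outside a
    large square, whose squares are summable, it shows that they contribute
    little. *)

Set Implicit Arguments.
Unset Strict Implicit.
Unset Printing Implicit Defensive.

Import Order.TTheory GRing.Theory Num.Theory.
Import numFieldNormedType.Exports.

Local Open Scope classical_set_scope.
Local Open Scope ring_scope.

(** * Real and complex scalars treated uniformly *)

Section Scalars.
Variables (R : realType) (k : scalar_kind).
Local Notation K := (scalar_field R k).

(** The embedding of the reals into the scalar field. Norms and nonnegative
    inner products are scalars; this map and [scalar_Re] carry them to and
    from [R], where all the estimates take place. *)
Definition scalar_of_real : R -> K :=
  match k return R -> scalar_field R k with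
  | RealScalars => fun x => x
  | ComplexScalars => real_complex R
  end.

Lemma scalar_of_realM x y :
  scalar_of_real (x * y) = scalar_of_real x * scalar_of_real y.
Proof. by rewrite /scalar_of_real; case: k => //; rewrite rmorphM. Qed.

Lemma scalar_of_real_ge0 x : (0 <= scalar_of_real x) = (0 <= x).
Proof. by rewrite /scalar_of_real; case: k => //; rewrite ler0c. Qed.

Lemma scalar_of_real_lt x y : (scalar_of_real x < scalar_of_real y) = (x < y).
Proof. by rewrite /scalar_of_real; case: k => //; rewrite ltcR. Qed.

Lemma scalar_of_real0 : scalar_of_real 0 = 0.
Proof. by rewrite /scalar_of_real; case: k. Qed.

Lemma scalar_Re_of_real x : scalar_Re (scalar_of_real x) = x.
Proof. by rewrite /scalar_of_real /scalar_Re; case: k. Qed.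

Lemma scalar_ReK (z : K) : 0 <= z -> scalar_of_real (scalar_Re z) = z.
Proof.
rewrite /scalar_of_real /scalar_Re; case: k z => //= z.
by move=> /ger0_Im; case: z => a b /= ->.
Qed.

Lemma scalar_Re_is_additive : zmod_morphism (@scalar_Re R k).
Proof. by rewrite /scalar_Re; case: k => //= -[a b] [c d]. Qed.

HB.instance Definition _ :=
  GRing.isZmodMorphism.Build K R (@scalar_Re R k) scalar_Re_is_additive.

Lemma scalar_ReMl x (z : K) : scalar_Re (scalar_of_real x * z) = x * scalar_Re z.
Proof.
rewrite /scalar_of_real /scalar_Re; case: k z => //= -[a b] /=.
by rewrite mul0r subr0.
Qed.

Lemma normE_modulus (z : K) : `|z| = scalar_of_real (modulus z).
Proof. by rewrite /modulus scalar_ReK. Qed.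

Lemma modulusM (z w : K) : modulus (z * w) = modulus z * modulus w.
Proof. by rewrite /modulus normrM {1}(normE_modulus z) scalar_ReMl. Qed.

Lemma scalar_Re_le_modulus (z : K) : scalar_Re z <= modulus z.
Proof.
rewrite /modulus /scalar_Re; case: k z => [z|z] /=; first exact: ler_norm.
have := normc_ge_Re z; rewrite normc_def /= lecR.
by case: z => a b /= h; exact: le_trans (ler_norm _) h.
Qed.

Lemma scalar_conjM_modulus (z : K) :
  z * scalar_conj z = scalar_of_real (modulus z ^+ 2).
Proof.
rewrite expr2 scalar_of_realM -normE_modulus.
rewrite /scalar_conj; case: k z => z.
  by have := @real_normK R z (num_real _); rewrite !expr2.
by rewrite -normCK expr2.
Qed.

Lemma modulus_conj (z : K) : modulus (scalar_conj z) = modulus z.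
Proof.
rewrite /modulus; congr scalar_Re; rewrite /scalar_conj; case: k z => // z.
exact: norm_conjC.
Qed.

Lemma scalar_Re_conj (z : K) : scalar_Re (scalar_conj z) = scalar_Re z.
Proof. by rewrite /scalar_conj /scalar_Re; case: k z => // -[]. Qed.

End Scalars.

(** * Squared norms in a Hilbert space *)

Section HilbertSpace.
Variables (R : realType) (k : scalar_kind).
Local Notation K := (scalar_field R k).
Variable X : hilbertSpace R k.
Implicit Types (x y : X) (c : K).

Local Notation "<< x , y >>" := (inner X x y).

Lemma inner_conj x y : <<x, y>> = scalar_conj <<y, x>>.
Proof. by rewrite [LHS]hermitian_subproof /= expr0 mul1r. Qed.

Lemma innerZl c x y : <<c *: x, y>> = c * <<x, y>>.
Proof. exact: linearZl_LR. Qed.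

Lemma innerZr c x y : <<x, c *: y>> = scalar_conj c * <<x, y>>.
Proof. exact: linearZr_LR. Qed.

(** The squared norm, as a real number. Using it in place of the norm avoids
    square roots: the estimates below rest on [Re_inner_le] and [hsqD_le]
    rather than on the Cauchy-Schwarz and triangle inequalities. *)
Definition hsq x : R := scalar_Re <<x, x>>.

Lemma norm_sqr x : `|x| ^+ 2 = scalar_of_real k (hsq x).
Proof. by rewrite norm_inner /hsq scalar_ReK // -norm_inner exprn_ge0. Qed.

Lemma hsq_ge0 x : 0 <= hsq x.
Proof. by rewrite -(scalar_of_real_ge0 k) -norm_sqr exprn_ge0. Qed.

Lemma hsq0 : hsq 0 = 0.
Proof. by rewrite /hsq linear0l raddf0. Qed.

Lemma hsqD x y : hsq (x + y) = hsq x + 2 * scalar_Re <<x, y>> + hsq y.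
Proof.
rewrite /hsq linearDl !linearDr !raddfD /= [<<y, x>>]inner_conj scalar_Re_conj.
by ring.
Qed.

Lemma hsqB x y : hsq (x - y) = hsq x - 2 * scalar_Re <<x, y>> + hsq y.
Proof.
rewrite hsqD /hsq linearNr linearNr linearNl /= opprK raddfN /=.
by ring.
Qed.

Lemma hsqZ c x : hsq (c *: x) = modulus c ^+ 2 * hsq x.
Proof.
by rewrite /hsq innerZl innerZr mulrA scalar_conjM_modulus scalar_ReMl.
Qed.

Lemma hsqN x : hsq (- x) = hsq x.
Proof. by rewrite /hsq linearNr linearNl opprK. Qed.

(** Weighted arithmetic-geometric mean inequality: expand the squared norm of
    [t *: x - y]. *)
Lemma Re_inner_le (t : R) x y : 0 < t ->
  2 * scalar_Re <<x, y>> <= t * hsq x + t^-1 * hsq y.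
Proof.
move=> t0; have := hsq_ge0 (scalar_of_real k t *: x - y).
have tE : modulus (scalar_of_real k t) = t.
  by rewrite /modulus ger0_norm ?scalar_of_real_ge0 ?ltW // scalar_Re_of_real.
rewrite hsqB hsqZ tE innerZl scalar_ReMl => h.
rewrite -(ler_pM2l t0) mulrDr mulrA mulVKf ?gt_eqF //.
rewrite -subr_ge0; apply: le_trans h _; rewrite le_eqVlt; apply/orP; left.
by apply/eqP; ring.
Qed.

Lemma hsqD_le x y : hsq (x + y) <= 2 * (hsq x + hsq y).
Proof.
have := Re_inner_le x y ltr01; rewrite hsqD invr1; lra.
Qed.

Lemma hsqD_ortho x y : <<x, y>> = 0 -> hsq (x + y) = hsq x + hsq y.
Proof. by move=> xy; rewrite hsqD xy raddf0 mulr0 addr0. Qed.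

Lemma cvg_hsqP (T : Type) (F : set_system T) {FF : Filter F} (f : T -> X) x :
  f @ F --> x <-> forall e : R, 0 < e -> \forall t \near F, hsq (x - f t) < e.
Proof.
split=> [/cvgrPdist_lt fx e e0|h].
  have := fx (scalar_of_real k (Num.sqrt e)).
  rewrite -(scalar_of_real0 R k) scalar_of_real_lt sqrtr_gt0 => /(_ e0).
  apply: filterS => t.
  rewrite -(@ltr_pXn2r _ 2) ?nnegrE ?scalar_of_real_ge0 ?sqrtr_ge0 //.
  by rewrite norm_sqr expr2 -scalar_of_realM scalar_of_real_lt -expr2 sqr_sqrtr ?ltW.
apply/cvgrPdist_lt => e e0.
have eE := scalar_ReK (ltW e0).
have e1 : 0 < scalar_Re e by rewrite -(scalar_of_real_lt k) eE scalar_of_real0.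
have := h (scalar_Re e ^+ 2); rewrite exprn_gt0 // => /(_ erefl).
apply: filterS => t /=.
rewrite -(scalar_of_real_lt k) -norm_sqr expr2 [X in _ < X]scalar_of_realM eE -expr2.
by rewrite ltr_pXn2r // nnegrE ?normr_ge0 // ltW.
Qed.

Lemma dense_hsq (D : set X) : dense D ->
  forall x (e : R), 0 < e -> exists2 h, D h & hsq (x - h) < e.
Proof.
move=> dD x e e0.
have /cvg_hsqP/(_ e e0) : (id : X -> X) @ nbhs x --> x by exact: cvg_id.
rewrite -nbhs_nearE nbhsE => -[V [oV Vx] VD].
have [h [Vh Dh]] := dD V (ex_intro _ x Vx) oV.
by exists h => //; exact: VD.
Qed.

End HilbertSpace.

(** * Bessel systems and dual systems *)

Section Bessel.
Variables (R : realType) (k : scalar_kind).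
Local Notation K := (scalar_field R k).
Variable X : hilbertSpace R k.
Implicit Types (x y : X) (c : nat -> K).

Local Notation "<< x , y >>" := (inner X x y).

(** A Bessel system with bound [B], in synthesis form: the finite linear
    combinations of the [x_ i] are bounded by the l2 norm of the
    coefficients. By [bessel_coef2] and [bessel_dense], for [0 < B] this is
    equivalent to the usual condition on the sums of squared coefficients of a
    vector, which it suffices to test on a dense set. *)
Definition bessel (B : R) (x_ : nat -> X) :=
  forall c N, hsq (\sum_(0 <= i < N) c i *: x_ i)
              <= B * \sum_(0 <= i < N) modulus (c i) ^+ 2.

(** Squared modulus of the [i]-th analysis coefficient of [x]. *)
Definition coef2 (x_ : nat -> X) x i : R := modulus <<x, x_ i>> ^+ 2.

(** Partial sums of the reconstruction of [x] from its [y_]-coefficients. *)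
Definition frame_sum (x_ y_ : nat -> X) x : X ^nat :=
  series (fun i => <<x, y_ i>> *: x_ i).

Lemma coef2_ge0 (x_ : nat -> X) x i : 0 <= coef2 x_ x i.
Proof. exact: sqr_ge0. Qed.

Lemma bessel_coef2 B (x_ : nat -> X) x N : 0 < B -> bessel B x_ ->
  \sum_(0 <= i < N) coef2 x_ x i <= B * hsq x.
Proof.
move=> B0 bx; set S := (X in X <= _).
set v : X := \sum_(0 <= i < N) <<x, x_ i>> *: x_ i.
have vB : hsq v <= B * S by exact: bx.
have xvE : scalar_Re <<x, v>> = S.
  rewrite /v linear_sumr raddf_sum; apply: eq_bigr => i _ /=.
  by rewrite innerZr mulrC scalar_conjM_modulus scalar_Re_of_real.
have := Re_inner_le x v B0; rewrite xvE => h.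
suff : B^-1 * hsq v <= S by lra.
by rewrite -(ler_pM2l B0) mulVKf ?gt_eqF.
Qed.

(** For [v] a finite combination and [h] in [D], the termwise inequality
    [2 |c| |d| <= B |c|^2 + |d|^2 / B] gives
    [2 Re <<v, h>> - |h|^2 <= B * sum |c i|^2]; the left-hand side is
    [|v|^2 - |v - h|^2], and [h] can be taken arbitrarily close to [v]. *)
Lemma bessel_dense B (D : set X) (x_ : nat -> X) : 0 < B -> dense D ->
  (forall h N, D h -> \sum_(0 <= i < N) coef2 x_ h i <= B * hsq h) ->
  bessel B x_.
Proof.
move=> B0 dD hD c N; set v := \sum_(0 <= i < N) _; set S := \sum_(0 <= i < N) _.
apply/ler_addgt0Pr => e e0; have [h Dh hv] := dense_hsq dD v e0.
suff h2 : 2 * scalar_Re <<v, h>> <= B * S + hsq h.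
  by move: hv; rewrite hsqB; lra.
rewrite /v linear_sumlz raddf_sum /= mulr_sumr.
have -> : B * S + hsq h = B * S + B^-1 * (B * hsq h).
  by rewrite mulKf ?gt_eqF.
apply: (@le_trans _ _ (B * S + B^-1 * \sum_(0 <= i < N) coef2 x_ h i)); last first.
  by rewrite lerD2l ler_pM2l ?invr_gt0 // hD.
rewrite /S !mulr_sumr -big_split /=; apply: ler_sum => i _.
rewrite innerZl; apply: (@le_trans _ _ (2 * (modulus (c i) * modulus <<h, x_ i>>))).
  rewrite ler_pM2l // inner_conj -(modulus_conj <<h, _>>) -modulusM.
  exact: scalar_Re_le_modulus.
rewrite /coef2; set a := modulus (c i); set b := modulus _.
have := sqr_ge0 (B * a - b); rewrite -(pmulr_rge0 _ (x := B^-1)) ?invr_gt0 // => h1.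
rewrite -subr_ge0; apply: le_trans h1 _; rewrite le_eqVlt; apply/orP; left.
by apply/eqP; field; rewrite gt_eqF.
Qed.

Lemma frame_sumB (x_ y_ : nat -> X) x y N :
  frame_sum x_ y_ (x - y) N = frame_sum x_ y_ x N - frame_sum x_ y_ y N.
Proof.
rewrite /frame_sum /series /= -sumrB; apply: eq_bigr => i _.
by rewrite linearBl /= scalerBl.
Qed.

Lemma hsq_frame_sum B (x_ y_ : nat -> X) x N : bessel B x_ ->
  hsq (frame_sum x_ y_ x N) <= B * \sum_(0 <= i < N) coef2 y_ x i.
Proof. by apply. Qed.

Lemma inner_frame_sum (x_ y_ : nat -> X) x N :
  <<frame_sum x_ y_ x N, x>> = <<x, frame_sum y_ x_ x N>>.
Proof.
rewrite /frame_sum /series /= linear_sumlz linear_sumr; apply: eq_bigr => i _ /=.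
by rewrite innerZl innerZr -inner_conj mulrC.
Qed.

(** The partial reconstruction operators are bounded by [B * B'] uniformly in
    [N], so their convergence to the identity extends from a dense set. *)
Lemma frame_sum_dense B B' (D : set X) (x_ y_ : nat -> X) : 0 < B -> 0 < B' ->
  bessel B x_ -> bessel B' y_ -> dense D ->
  (forall h, D h -> frame_sum x_ y_ h @ \oo --> h) ->
  forall x, frame_sum x_ y_ x @ \oo --> x.
Proof.
move=> B0 B'0 bx by_ dD hD x; apply/cvg_hsqP => e e0.
(* The squared error is at most [2 (d + 2 (d + B B' d))]. *)
pose d := e / (6 + 4 * (B * B')).
have den0 : 0 < 6 + 4 * (B * B') by rewrite addr_gt0 // !mulr_gt0.
have d0 : 0 < d by rewrite divr_gt0.
have dE : (6 + 4 * (B * B')) * d = e by rewrite mulrC divfK ?gt_eqF.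
have [h Dh xh] := dense_hsq dD x d0.
have /cvg_hsqP/(_ _ d0) := hD _ Dh; apply: filterS => N hN.
have -> : x - frame_sum x_ y_ x N =
   (x - h) + ((h - frame_sum x_ y_ h N) + - frame_sum x_ y_ (x - h) N).
  by rewrite frame_sumB opprB (addrA (h - _)) subrK addrA subrK.
have h1 := hsqD_le (x - h) ((h - frame_sum x_ y_ h N) + - frame_sum x_ y_ (x - h) N).
have h2 := hsqD_le (h - frame_sum x_ y_ h N) (- frame_sum x_ y_ (x - h) N).
rewrite hsqN in h2.
have h3 := hsq_frame_sum y_ (x - h) N bx.
have h4 : B * \sum_(0 <= i < N) coef2 y_ (x - h) i <= B * B' * d.
  by rewrite -mulrA ler_pM2l // (le_trans (bessel_coef2 _ _ _ by_)) // ler_pM2l // ltW.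
nra.
Qed.

(** Two Bessel systems such that every vector is reconstructed from its
    [y_]-coefficients by the [x_]. *)
Definition dual_systems (x_ y_ : nat -> X) := exists B B' : R,
  [/\ 0 < B, 0 < B', bessel B x_, bessel B' y_ &
      forall x, frame_sum x_ y_ x @ \oo --> x].

Local Open Scope ereal_scope.

Lemma coef2_sum_le (x_ : nat -> X) B x : (0 < B)%R -> bessel B x_ ->
  \sum_(i <oo) (coef2 x_ x i)%:E <= (B * hsq x)%:E.
Proof.
move=> B0 bx; apply: lime_le.
  by apply: is_cvg_nneseries => i _ _; rewrite lee_fin coef2_ge0.
by apply: nearW => N; rewrite sumEFin lee_fin bessel_coef2.
Qed.

Lemma coef2_sum_ge (x_ : nat -> X) B x : (0 < B)%R ->
  (forall e : R, (0 < e)%R -> exists N,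
    hsq x <= B * \sum_(0 <= i < N) coef2 x_ x i + e)%R ->
  (B^-1 * hsq x)%:E <= \sum_(i <oo) (coef2 x_ x i)%:E.
Proof.
move=> B0 h; apply/lee_addgt0Pr => e e0.
have [N hN] := h (B * e)%R (mulr_gt0 B0 e0).
apply: (@le_trans _ _ ((\sum_(0 <= i < N) coef2 x_ x i)%R%:E + e%:E)).
  by rewrite -EFinD lee_fin -(ler_pM2l B0) mulVKf ?gt_eqF// mulrDr.
rewrite leeD2r // -sumEFin; apply: nneseries_lim_ge => i _.
by rewrite lee_fin coef2_ge0.
Qed.

(** A frame of a Hilbert space: two-sided bounds at every vector of the space. *)
Definition hilbert_frame (x_ : nat -> X) := exists A B : R,
  [/\ (0 < A)%R, (A <= B)%R & forall x,
    (A * hsq x)%:E <= \sum_(i <oo) (coef2 x_ x i)%:E <= (B * hsq x)%:E].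

(** The lower frame bounds come from the reconstruction formula and the Bessel
    bound of the other system. Here [Re <<S, x>>] for a partial reconstruction
    [S] of [x] equals [Re <<x, S'>>], with [S'] the partial sum built from the
    [x_]-coefficients on the [y_]. *)
Lemma dual_systems_frame_left (x_ y_ : nat -> X) : dual_systems x_ y_ -> hilbert_frame x_.
Proof.
move=> [B [B' [B0 B'0 bx by_ rec]]].
pose A := ((2 * B')^-1)%R.
have A0 : (0 < A)%R by rewrite invr_gt0 mulr_gt0.
exists A, (A + B)%R; split => //; first by rewrite lerDl ltW.
move=> x; apply/andP; split; last first.
  apply: le_trans (coef2_sum_le x B0 bx) _.
  by rewrite lee_fin ler_wpM2r ?hsq_ge0 // lerDr ltW.
apply: coef2_sum_ge; first by rewrite mulr_gt0.
move=> e e0; have e20 : (0 < e / 2)%R by rewrite divr_gt0.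
have /cvg_hsqP/(_ _ e20)[N _ /(_ N (leqnn N)) /= hN] := rec x.
exists N; set S := frame_sum _ _ _ _ in hN.
have h1 := Re_inner_le (x - S)%R x (ltr0n _ 2).
have h2 : (2 * scalar_Re <<x, frame_sum y_ x_ x N>> <=
    2^-1 * hsq x + 2 * hsq (frame_sum y_ x_ x N))%R.
  by rewrite -[X in (_ + X * _)%R]invrK; apply: Re_inner_le; rewrite invr_gt0.
have h3 := hsq_frame_sum x_ x N by_.
have h4 : hsq x = (scalar_Re << x - S, x >> + scalar_Re <<x, frame_sum y_ x_ x N>>)%R.
  by rewrite -inner_frame_sum -raddfD -linearDl subrK.
lra.
Qed.

Lemma dual_systems_frame_right (x_ y_ : nat -> X) :
  dual_systems x_ y_ -> hilbert_frame y_.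
Proof.
move=> [B [B' [B0 B'0 bx by_ rec]]].
pose A := ((2 * B)^-1)%R.
have A0 : (0 < A)%R by rewrite invr_gt0 mulr_gt0.
exists A, (A + B')%R; split => //; first by rewrite lerDl ltW.
move=> x; apply/andP; split; last first.
  apply: le_trans (coef2_sum_le x B'0 by_) _.
  by rewrite lee_fin ler_wpM2r ?hsq_ge0 // lerDr ltW.
apply: coef2_sum_ge; first by rewrite mulr_gt0.
move=> e e0; have e20 : (0 < e / 2)%R by rewrite divr_gt0.
have /cvg_hsqP/(_ _ e20)[N _ /(_ N (leqnn N)) /= hN] := rec x.
exists N; set S := frame_sum _ _ _ _ in hN.
have := hsqD_le (x - S)%R S; rewrite subrK => h1.
have h3 := hsq_frame_sum y_ x N bx.
rewrite -/S in h3; lra.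
Qed.

End Bessel.

(** * Passage to the Hilbert space completion *)

Section Completion.
Variables (R : realType) (k : scalar_kind) (n : nat).
Local Notation K := (scalar_field R k).
Variables (H : lmodType K) (ip : H -> H -> n.-1.-tuple H -> K).
Variables (a : n.-1.-tuple H) (HF : completion ip a).

Lemma n_norm_sqr p : n_norm ip p a ^+ 2 = hsq (hclass HF p).
Proof.
by rewrite /n_norm -(hclass_inner HF) -/(hsq _) sqr_sqrtr // hsq_ge0.
Qed.

Lemma frame_bessel p_ : frame ip a p_ ->
  exists2 B : R, 0 < B & bessel B (hclass HF \o p_).
Proof.
move=> [A [B [A0 AB fp]]]; have B0 : 0 < B by exact: lt_le_trans AB.
exists B => //; apply: (bessel_dense B0 (hclass_dense (c:=HF))) => _ N [p _ <-].
have /andP[_] := fp p; rewrite n_norm_sqr -lee_fin; apply: le_trans.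
rewrite -sumEFin; under eq_bigr do rewrite /coef2 /= hclass_inner.
by apply: nneseries_lim_ge => i _; rewrite lee_fin sqr_ge0.
Qed.

Lemma dual_frames_systems p_ e_ : dual_frames HF p_ e_ ->
  dual_systems (hclass HF \o p_) (hclass HF \o e_).
Proof.
move=> [/frame_bessel[B B0 bp] /frame_bessel[B' B'0 be] rec].
exists B, B'; split => //.
apply: (frame_sum_dense B0 B'0 bp be (hclass_dense (c:=HF))) => _ [p _ <-].
rewrite /frame_sum /=; under eq_fun do rewrite hclass_inner.
exact: rec.
Qed.

End Completion.

(** * Invariance under unitary operators *)

Section Unitary.
Variables (R : realType) (k : scalar_kind) (X : hilbertSpace R k).
Variables (U : {linear X -> X}) (hU : unitary_operator U).

Lemma unitary_hsq x : hsq (U x) = hsq x.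
Proof.
by move: hU => [_ [U' [_ adjU _ UK]]]; rewrite /hsq adjU UK.
Qed.

Lemma bessel_unitary B (x_ : nat -> X) : bessel B x_ -> bessel B (U \o x_).
Proof.
move=> bx c N.
have -> : \sum_(0 <= i < N) c i *: (U \o x_) i = U (\sum_(0 <= i < N) c i *: x_ i).
  by rewrite raddf_sum; apply: eq_bigr => i _ /=; rewrite linearZ_LR.
by rewrite unitary_hsq.
Qed.

Lemma dual_systems_unitary (x_ y_ : nat -> X) :
  dual_systems x_ y_ -> dual_systems (U \o x_) (U \o y_).
Proof.
move=> [B [B' [B0 B'0 bx by_ rec]]].
exists B, B'; split => //; try exact: bessel_unitary.
move=> x; move: (hU) => [_ [U' [_ adjU U'K _]]].
have SE N : frame_sum (U \o x_) (U \o y_) x N = U (frame_sum x_ y_ (U' x) N).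
  rewrite /frame_sum /series /= raddf_sum; apply: eq_bigr => i _ /=.
  by rewrite linearZ_LR /= inner_conj adjU -inner_conj.
apply/cvg_hsqP => e e0.
have /cvg_hsqP/(_ _ e0) := rec (U' x); apply: filterS => N.
suff -> : x - frame_sum (U \o x_) (U \o y_) x N = U (U' x - frame_sum x_ y_ (U' x) N).
  by rewrite unitary_hsq.
by rewrite SE linearB U'K.
Qed.

End Unitary.

(** * Bessel bounds in the tensor product *)

Section TensorBessel.
Variables (R : realType) (k : scalar_kind) (X Y : hilbertSpace R k).
Local Notation K := (scalar_field R k).
Variable T : hilbertTensor X Y.

Lemma hsq_tens x y : hsq (tens T x y) = hsq x * hsq y.
Proof.
rewrite /hsq tens_inner.
have /scalar_ReK <- : 0 <= inner X x x by rewrite -norm_inner exprn_ge0.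
by rewrite scalar_ReMl scalar_Re_of_real.
Qed.

Lemma tensDr x y y' : tens T x (y + y') = tens T x y + tens T x y'.
Proof. exact: linearDr. Qed.

Lemma tensZl c x y : tens T (c *: x) y = c *: tens T x y.
Proof. exact: linearZl_LR. Qed.

Lemma tensZr c x y : tens T x (c *: y) = c *: tens T x y.
Proof. exact: linearZr_LR. Qed.

(** A Bessel bound extends from scalar to vector coefficients. By induction on
    a bound for the indices of the nonzero [z_ i]: splitting off the component
    of every [z_ i] along the last one leaves orthogonal remainders, with one
    more of them zero, and the
    part split off is a single tensor, bounded by the hypothesis on [x_]. *)
Lemma bessel_tens B (x_ : nat -> X) (z_ : nat -> Y) N :
  0 < B -> bessel B x_ ->
  hsq (\sum_(0 <= i < N) tens T (x_ i) (z_ i)) <= B * \sum_(0 <= i < N) hsq (z_ i).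
Proof.
move=> B0 bx.
(* [m] bounds the indices of the nonzero [z i]. *)
suff h m : forall z : nat -> Y, (forall i, (m <= i)%N -> z i = 0) ->
   hsq (\sum_(0 <= i < N) tens T (x_ i) (z i)) <= B * \sum_(0 <= i < N) hsq (z i).
  have := h N (fun i => if (i < N)%N then z_ i else 0).
  under [X in hsq X]eq_big_nat => i /andP[_ ->] do over.
  under [X in _ * X]eq_big_nat => i /andP[_ ->] do over.
  by apply => i; rewrite leqNgt => /negbTE ->.
elim: m => [|m IH] z zm.
  rewrite big1 => [|i _]; last by rewrite zm // linear0r.
  rewrite hsq0; apply: mulr_ge0; first exact: ltW.
  by apply: sumr_ge0 => i _; exact: hsq_ge0.
pose y := z m; pose c i := inner Y (z i) y / inner Y y y.
(* The projection along [y]; when [y = 0] the quotient [c i] is [0]. *)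
pose z' i := z i - c i *: y.
have z'y i : inner Y (z' i) y = 0.
  rewrite /z' linearBl /= innerZl /c; have [->|y0] := eqVneq y 0.
    by rewrite !linear0r subrr.
  by rewrite divfK ?subrr // gt_eqF // neq0_dnorm_gt0.
have zE i : z i = z' i + c i *: y by rewrite /z' subrK.
have z'm i : (m <= i)%N -> z' i = 0.
  rewrite leq_eqVlt => /orP[/eqP <-|mi]; last first.
    by rewrite /z' /c zm // linear0l mul0r scale0r subrr.
  rewrite /z' /c -/y; have [->|y0] := eqVneq y 0.
    by rewrite scaler0 subrr.
  by rewrite divff ?scale1r ?subrr // gt_eqF // neq0_dnorm_gt0.
have -> : \sum_(0 <= i < N) tens T (x_ i) (z i) =
   \sum_(0 <= i < N) tens T (x_ i) (z' i) +
   tens T (\sum_(0 <= i < N) c i *: x_ i) y.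
  rewrite linear_sumlz -big_split /=; apply: eq_bigr => i _.
  by rewrite [in LHS]zE tensDr tensZr tensZl.
have -> : \sum_(0 <= i < N) hsq (z i) = \sum_(0 <= i < N) hsq (z' i) +
   (\sum_(0 <= i < N) modulus (c i) ^+ 2) * hsq y.
  rewrite mulr_suml -big_split /=; apply: eq_bigr => i _.
  rewrite [in LHS]zE hsqD_ortho ?hsqZ //.
  by rewrite innerZr z'y mulr0.
rewrite hsqD_ortho; last first.
  rewrite linear_sumlz big1 // => i _ /=.
  by rewrite tens_inner z'y mulr0.
rewrite mulrDr lerD ?IH // hsq_tens mulrA ler_wpM2r ?hsq_ge0 //.
Qed.

(** Apply [bessel_tens] with [z_ i] the sum over [j] of [c i j *: y_ j]. *)
Lemma bessel_tens_double B B' (x_ : nat -> X) (y_ : nat -> Y) (c : nat -> nat -> K) N :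
  0 < B -> bessel B x_ -> bessel B' y_ ->
  hsq (\sum_(0 <= i < N) \sum_(0 <= j < N) c i j *: tens T (x_ i) (y_ j))
  <= B * B' * \sum_(0 <= i < N) \sum_(0 <= j < N) modulus (c i j) ^+ 2.
Proof.
move=> B0 bx by_.
under eq_bigr => i _.
  under eq_bigr do rewrite -tensZr.
  rewrite -linear_sumr.
  over.
apply: le_trans (bessel_tens _ _ B0 bx) _.
by rewrite -mulrA ler_pM2l // mulr_sumr ler_sum.
Qed.

End TensorBessel.

(** * Sums over finite sets of pairs *)

Section BoxSums.

(** The square of the pairs of indices smaller than [N]. *)
Definition box N : {fset nat * nat} :=
  [fset ij in [seq (i, j) | i <- iota 0 N, j <- iota 0 N]]%fset.

Lemma in_box N ij : (ij \in box N) = (ij.1 < N)%N && (ij.2 < N)%N.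
Proof.
rewrite inE; case: ij => i j /=.
apply/allpairsP/andP => [[[i' j'] /= []]|[iN jN]].
  by rewrite !mem_iota => iN jN [-> ->].
by exists (i, j); rewrite /= !mem_iota.
Qed.

Lemma sum_box (V : nmodType) (F : nat * nat -> V) N :
  \sum_(ij <- box N) F ij = \sum_(0 <= i < N) \sum_(0 <= j < N) F (i, j).
Proof.
rewrite /index_iota subn0 -big_allpairs.
apply: perm_big; apply: uniq_perm => [||ij]; first exact: fset_uniq.
  by apply: allpairs_uniq; rewrite ?iota_uniq // => -[? ?] [? ?] _ _ [-> ->].
by rewrite inE.
Qed.

Lemma sum_fset_box (V : nmodType) (F : nat * nat -> V) (J : {fset nat * nat}) N :
  (J `<=` box N)%fset ->
  \sum_(ij <- J) F ij =
  \sum_(0 <= i < N) \sum_(0 <= j < N) if (i, j) \in J then F (i, j) else 0.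
Proof.
move=> JN; rewrite -(sum_box (fun ij => if ij \in J then F ij else 0)).
rewrite -(big_fset_incl (A := J) _ JN) => [|ij _ /negbTE ->] //.
by apply: eq_big_seq => ij ->.
Qed.

Lemma fset_sub_box (J : {fset nat * nat}) : exists N, (J `<=` box N)%fset.
Proof.
exists (\max_(ij <- J) (maxn ij.1 ij.2).+1); apply/fsubsetP => ij ijJ.
rewrite in_box -gtn_max.
exact: (@leq_bigmax_seq _ _ xpredT (fun ij : nat * nat => (maxn ij.1 ij.2).+1)).
Qed.

End BoxSums.

(** * Frames and unconditional reconstruction in the tensor product *)

(** The analysis coefficients are square summable. *)
Lemma coef2_series_cvg (R : realType) (k : scalar_kind) (X : hilbertSpace R k)
    (x_ : nat -> X) B x : 0 < B -> bessel B x_ ->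
  exists2 C : R, series (coef2 x_ x) @ \oo --> C &
    forall N, series (coef2 x_ x) N <= C.
Proof.
move=> B0 bx; set u := series _.
have nd : nondecreasing_seq u.
  apply/nondecreasing_seqP => N; rewrite /u /series /= big_nat_recr //= lerDl.
  exact: coef2_ge0.
have cu : cvgn u.
  apply: nondecreasing_is_cvgn => //; exists (B * hsq x) => _ [N _ <-].
  exact: bessel_coef2.
by exists (limn u) => // N; exact: nondecreasing_cvgn_le.
Qed.

Section TensorReconstruction.
Variables (R : realType) (k : scalar_kind) (X Y : hilbertSpace R k).
Local Notation K := (scalar_field R k).
Variable T : hilbertTensor X Y.

Lemma bessel_tens_fset B B' (x_ : nat -> X) (y_ : nat -> Y)
    (c : nat * nat -> K) (J : {fset nat * nat}) :
  0 < B -> bessel B x_ -> bessel B' y_ ->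
  hsq (\sum_(ij <- J) c ij *: tens T (x_ ij.1) (y_ ij.2))
  <= B * B' * \sum_(ij <- J) modulus (c ij) ^+ 2.
Proof.
move=> B0 bx by_; have [N JN] := fset_sub_box J.
rewrite !(sum_fset_box _ JN).
have := bessel_tens_double T
  (fun i j => if (i, j) \in J then c (i, j) else 0) N B0 bx by_.
congr (hsq _ <= _ * _); apply: eq_bigr => i _; apply: eq_bigr => j _.
  by case: ifP => //; rewrite scale0r.
by case: ifP => //; rewrite /modulus normr0 raddf0 expr0n.
Qed.

Lemma cvg_tens (I : Type) (F : set_system I) {FF : Filter F}
    (f : I -> X) (g : I -> Y) x y :
  f @ F --> x -> g @ F --> y -> (fun i => tens T (f i) (g i)) @ F --> tens T x y.
Proof.
move=> /cvg_hsqP fx /cvg_hsqP gy; apply/cvg_hsqP => e e0.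
have hx := hsq_ge0 x; have hy := hsq_ge0 y.
(* Eventually [hsq (f i) <= 2 (hsq x + 1)], so that the squared norms of
   [(x - f i) (x) y] and [f i (x) (y - g i)] are both less than [e / 4]. *)
have x1 : 0 < 8 * (hsq x + 1) by lra.
have y1 : 0 < 4 * (hsq y + 1) by lra.
have := fx _ ltr01; have := fx _ (divr_gt0 e0 y1); have := gy _ (divr_gt0 e0 x1).
apply: filterS3 => i.
rewrite !ltr_pdivlMr // => h1 h2 h3.
have -> : tens T x y - tens T (f i) (g i) = tens T (x - f i) y + tens T (f i) (y - g i).
  by rewrite linearBl linearBr /= addrA subrK.
apply: le_lt_trans (hsqD_le _ _) _; rewrite !hsq_tens.
have h4 : hsq (f i) <= 2 * (hsq x + 1).
  have := hsqD_le x (- (x - f i)).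
  rewrite hsqN opprB addrC subrK; lra.
have h5 := hsq_ge0 (x - f i); have h6 := hsq_ge0 (y - g i).
have h7 : hsq (f i) * hsq (y - g i) <= 2 * (hsq x + 1) * hsq (y - g i).
  by rewrite ler_wpM2r.
have h8 : hsq (x - f i) * hsq y <= hsq (x - f i) * (hsq y + 1).
  by rewrite ler_wpM2l // lerDl.
nra.
Qed.

(** The partial sum over a square is the tensor of two partial reconstructions,
    hence close to [tens T x y]; over a finite set [J] containing the square,
    the remaining part is bounded by [bessel_tens_fset] and by the tail of the
    product of the two convergent series of squared coefficients. *)
Lemma dual_systems_tens_cvg (x_ x'_ : nat -> X) (y_ y'_ : nat -> Y) x y :
  dual_systems x_ x'_ -> dual_systems y_ y'_ ->
  summability.partial_sum (fun ij : nat * nat =>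
     (inner X x (x'_ ij.1) * inner Y y (y'_ ij.2)) *: tens T (x_ ij.1) (y_ ij.2))
    @ summability.totally --> tens T x y.
Proof.
move=> [B [B' [B0 B'0 bx bx' recx]]] [D [D' [D0 D'0 by_ by' recy]]].
pose c ij := inner X x (x'_ ij.1) * inner Y y (y'_ ij.2).
pose f ij := c ij *: tens T (x_ ij.1) (y_ ij.2).
have FF := @summability.totally_filter (nat * nat)%type.
apply/cvg_hsqP => e e0.
have cE ij : modulus (c ij) ^+ 2 = coef2 x'_ x ij.1 * coef2 y'_ y ij.2.
  by rewrite modulusM exprMn.
have box_f N : \sum_(ij <- box N) f ij =
    tens T (frame_sum x_ x'_ x N) (frame_sum y_ y'_ y N).
  rewrite sum_box linear_sumlz; apply: eq_bigr => i _.
  rewrite /= linear_sumr; apply: eq_bigr => j _ /=.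
  by rewrite tensZl tensZr scalerA.
have [C cvgC leC] := coef2_series_cvg x B'0 bx'.
have [E cvgE leE] := coef2_series_cvg y D'0 by'.
have box_c N : \sum_(ij <- box N) modulus (c ij) ^+ 2 =
    series (coef2 x'_ x) N * series (coef2 y'_ y) N.
  rewrite sum_box mulr_suml; apply: eq_bigr => i _.
  by rewrite mulr_sumr; apply: eq_bigr => j _; rewrite cE.
have sum_c (J : {fset nat * nat}) : \sum_(ij <- J) modulus (c ij) ^+ 2 <= C * E.
  have [N JN] := fset_sub_box J.
  apply: (@le_trans _ _ (\sum_(ij <- box N) modulus (c ij) ^+ 2)).
    rewrite sum_box (sum_fset_box _ JN); apply: ler_sum => i _; apply: ler_sum => j _.
    by case: ifP => // _; exact: sqr_ge0.
  by rewrite box_c ler_pM // sumr_ge0 // => i _; exact: coef2_ge0.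
have d0 : 0 < e / (4 * (B * D)) by rewrite divr_gt0 ?mulr_gt0.
have e40 : 0 < e / 4 by rewrite divr_gt0.
have cvgCE : \forall N \near \oo,
    `|C * E - series (coef2 x'_ x) N * series (coef2 y'_ y) N| < e / (4 * (B * D)).
  by have /cvgrPdist_lt : series (coef2 x'_ x) \* series (coef2 y'_ y) @ \oo --> C * E;
    [exact: cvgM | exact].
have cvgT : \forall N \near \oo,
    hsq (tens T x y - tens T (frame_sum x_ x'_ x N) (frame_sum y_ y'_ y N)) < e / 4.
  by move: (e / 4) e40; apply/cvg_hsqP; exact: cvg_tens.
have [N [N1 N2]] : exists N, `|C * E - series (coef2 x'_ x) N * series (coef2 y'_ y) N| <
      e / (4 * (B * D)) /\
   hsq (tens T x y - tens T (frame_sum x_ x'_ x N) (frame_sum y_ y'_ y N)) < e / 4.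
  by have [N _ /(_ N (leqnn N))] := filterI cvgCE cvgT; exists N.
exists (box N) => // J /= NJ.
rewrite /summability.partial_sum -(big_seq_fsetE _ J xpredT f) /=.
(* Split a sum over [J] into the square and the rest. *)
have split_sum (V : nmodType) (F : nat * nat -> V) :
    \sum_(ij <- J) F ij = \sum_(ij <- box N) F ij + \sum_(ij <- (J `\` box N)%fset) F ij.
  rewrite (big_fsetID _ (mem (box N))) /=; congr (_ + _); apply: eq_fbigl => ij.
    by rewrite in_fset inE /= andb_idl // => ijN; exact: (fsubsetP NJ).
  by rewrite !inE /= andbC.
rewrite split_sum box_f opprD addrA.
apply: le_lt_trans (hsqD_le _ _) _; rewrite hsqN.
have := bessel_tens_fset c (J `\` box N)%fset B0 bx by_.
have := sum_c J; rewrite split_sum box_c => h1 h2.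
have h3 : B * D * \sum_(ij <- (J `\` box N)%fset) modulus (c ij) ^+ 2 <= e / 4.
  rewrite mulrC -ler_pdivlMr ?mulr_gt0 // -mulrA -invfM.
  by have := ler_norm (C * E - series (coef2 x'_ x) N * series (coef2 y'_ y) N); lra.
rewrite /f; lra.
Qed.

End TensorReconstruction.

Section TensorFrame.
Variables (R : realType) (k : scalar_kind) (n : nat).
Local Notation K := (scalar_field R k).
Variables (H1 H2 : lmodType K).
Variables (ip1 : H1 -> H1 -> n.-1.-tuple H1 -> K)
          (ip2 : H2 -> H2 -> n.-1.-tuple H2 -> K).
Variables (a : n.-1.-tuple H1) (b : n.-1.-tuple H2).
Variables (HF : completion ip1 a) (KG : completion ip2 b).

Local Open Scope ereal_scope.

(** Tonelli for a product; finiteness of one factor is needed to take it out of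
    the sum over [i]. *)
Lemma esum_coef2_tens (u : nat -> HF) (v : nat -> KG) x y :
  \sum_(j <oo) (coef2 v y j)%:E \is a fin_num ->
  \esum_(ij in [set: nat * nat])
     (modulus (tensor_ip x y (u ij.1) (v ij.2)) ^+ 2)%:E =
  (\sum_(i <oo) (coef2 u x i)%:E) * (\sum_(j <oo) (coef2 v y j)%:E).
Proof.
move=> vfin; have c0 (Z : hilbertSpace R k) (w : nat -> Z) z i : 0 <= (coef2 w z i)%:E.
  by rewrite lee_fin coef2_ge0.
have setXE : setT `*`` (fun _ : nat => [set: nat]) = [set: nat * nat].
  by apply/seteqP; split.
rewrite -setXE -(@esum_esum _ _ _ _ _
  (fun i j => (modulus (tensor_ip x y (u i) (v j)) ^+ 2)%:E));
  last by move=> i j _ _; rewrite lee_fin sqr_ge0.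
under eq_esum => i _.
  under eq_esum => j _ do
    rewrite /tensor_ip modulusM exprMn EFinM -/(coef2 u x i) -/(coef2 v y j).
  rewrite -nneseries_esumT => [|j]; last exact: mule_ge0.
  rewrite nneseriesZl //; over.
have v0 : 0 <= \sum_(j <oo) (coef2 v y j)%:E by exact: nneseries_ge0.
rewrite -nneseries_esumT => [|i]; last exact: mule_ge0.
rewrite -(fineK vfin) muleC -nneseriesZl //.
by apply: eq_eseriesr => i _; rewrite muleC.
Qed.

Lemma hilbert_frame_tensor (u : nat -> HF) (v : nat -> KG) :
  hilbert_frame u -> hilbert_frame v -> tensor_frame u v.
Proof.
move=> [A [B [A0 AB hu]]] [A' [B' [A'0 AB' hv]]].
exists (A * A')%R, (B * B')%R; split.
- by rewrite mulr_gt0.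
- by rewrite ler_pM // ltW.
move=> p q; rewrite esum_coef2_tens; last first.
  rewrite ge0_fin_numE; last first.
    by apply: nneseries_ge0 => j _ _; rewrite lee_fin; exact: coef2_ge0.
  by have /andP[_ /le_lt_trans] := hv (hclass KG q); apply; exact: ltry.
rewrite /tensor_n_norm exprMn (n_norm_sqr HF) (n_norm_sqr KG).
have /andP[u1 u2] := hu (hclass HF p).
have /andP[v1 v2] := hv (hclass KG q).
rewrite mulrACA (mulrACA B) !EFinM; apply/andP; split.
  by apply: lee_pmul; rewrite // lee_fin mulr_ge0 ?hsq_ge0 ?ltW.
apply: lee_pmul => //; apply: nneseries_ge0 => i _ _; rewrite lee_fin;
  exact: coef2_ge0.
Qed.

End TensorFrame.

(** * Dual frames of a tensor product of n-Hilbert spaces *)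

Local Close Scope classical_set_scope.

Theorem theorem4p7 (R : realType) (k : scalar_kind) (n : nat) (hn : (2 <= n)%N)
    (H K : lmodType (scalar_field R k))
    (ip1 : H -> H -> n.-1.-tuple H -> scalar_field R k)
    (ip2 : K -> K -> n.-1.-tuple K -> scalar_field R k)
    (hH : n_hilbert_space ip1) (hK : n_hilbert_space ip2)
    (a : n.-1.-tuple H) (b : n.-1.-tuple K)
    (ha : linearly_independent a) (hb : linearly_independent b)
    (HF : completion ip1 a) (KG : completion ip2 b)
    (T : hilbertTensor HF KG)
    (p_ e_ : nat -> H) (q_ h_ : nat -> K)
    (hpe : dual_frames HF p_ e_) (hqh : dual_frames KG q_ h_)
    (U : {linear HF -> HF}) (V : {linear KG -> KG})
    (hU : unitary_operator U) (hV : unitary_operator V)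
    (W : {linear T -> T}) (hW : tensor_operator U V W) :
  dual_tensor_frames
    (fun i j => W (tens T (hclass HF (p_ i)) (hclass KG (q_ j))))
    (fun i j => W (tens T (hclass HF (e_ i)) (hclass KG (h_ j)))).
Proof.
have {}hpe := dual_systems_unitary hU (dual_frames_systems hpe).
have {}hqh := dual_systems_unitary hV (dual_frames_systems hqh).
exists (U \o (hclass HF \o p_)), (U \o (hclass HF \o e_)),
       (V \o (hclass KG \o q_)), (V \o (hclass KG \o h_)).
split.
- split; first by move=> i j; exact: hW.2.
  exact: hilbert_frame_tensor (dual_systems_frame_left hpe) (dual_systems_frame_left hqh).
- split; first by move=> i j; exact: hW.2.
  exact: hilbert_frame_tensor (dual_systems_frame_right hpe)
    (dual_systems_frame_right hqh).
- by move=> p q; exact: dual_systems_tens_cvg.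
Qed.
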